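(* Let $(R,\mathfrak m)$ be a one-dimensional local domain with infinite residue class field and multiplicity $e(R)=2$, and let $I\subset R$ be an ideal. Then $\mathrm{Fitt}_1(I)=I$ if and only if $I$ is a trace ideal.
   Context: Rings are commutative with unit and Noetherian. For a finitely generated module $M$ over a Noetherian ring $R$, choose a finite free presentation $G\to F\to M\to 0$ with $\mathrm{rank}\,F=r$, and let $A$ be a matrix representing $G\to F$. The $j$th Fitting ideal of $M$ is $\mathrm{Fitt}_j(M)=I_{r-j}(A)$, where $I_t(A)$ is the ideal generated by the $t$-minors of $A$, with $I_t(A)=R$ for $t\le 0$. This is independent of the choices. An ideal $I$ is regarded as an $R$-module. The trace of an $R$-module $M$ is the ideal $\mathrm{tr}(M)=\sum_{\varphi\in \mathrm{Hom}_R(M,R)}\varphi(M)$. An ideal $I$ is a trace ideal if $I=\mathrm{tr}(M)$ for some $R$-module $M$ (equivalently, $I=\mathrm{tr}(I)$). $e(R)$ is the Hilbert-Samuel multiplicity of $R$ with respect to $\mathfrak m$.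
   Formalization: The ideal I is assumed nonzero; for I = 0 the statement fails, since 0 = tr(0) is a trace ideal while Fitt_1(0) = R. *)

(* Defs.v *)
From HB Require Import structures.
From mathcomp Require Import all_boot all_order all_algebra.
From mathcomp Require Import mathcomp_extra boolp classical_sets functions.
From mathcomp Require Import cardinality.

Set Implicit Arguments.
Unset Strict Implicit.
Unset Printing Implicit Defensive.

Import GRing.Theory.

Local Open Scope classical_set_scope.
Local Open Scope ring_scope.

(* Ideals are the R-submodules of the regular module R^o. Membership is boolean,
   which is no restriction since the development is classical. *)
Notation ideal R := (submodClosed (GRing.regular R)).

Section Modules.
Context {R : nzRingType} {V : lmodType R}.

Inductive submod_type (I : submodClosed V) : predArgType :=
  SubmodType x & x \in I.

Definition submod_val (I : submodClosed V) (u : submod_type I) : V :=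
  let: SubmodType x _ := u in x.

Variable I : submodClosed V.

HB.instance Definition _ := [isSub for @submod_val I].
HB.instance Definition _ := [Choice of submod_type I by <:].
HB.instance Definition _ := [SubChoice_isSubLmodule of submod_type I by <:].

End Modules.

Section Ideals.
Context {R : comNzRingType}.
Implicit Types (I J m p : ideal R) (S : set R).

Definition ideal_gen S : set R :=
  [set x | forall J, S `<=` [set` J] -> x \in J].

Definition maximal_ideal m : Prop :=
  [set` m] != setT /\
  forall J, [set` m] `<=` [set` J] -> [set` J] = [set` m] \/ [set` J] = setT.

Definition local_ring m : Prop :=
  maximal_ideal m /\ forall m', maximal_ideal m' -> [set` m'] = [set` m].

(* The elements of the residue class field R/m, as cosets. *)
Definition residue_field m : set (set R) :=
  range (fun x : R => [set y | y - x \in m]).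

Definition prime_ideal p : Prop :=
  1 \notin p /\ forall x y : R, x * y \in p -> x \in p \/ y \in p.

Definition strict_chain (P : ideal R -> Prop) (n : nat) : Prop :=
  exists c : 'I_n.+1 -> ideal R,
    (forall i, P (c i)) /\
    (forall i j : 'I_n.+1, (i < j)%N -> [set` c i] `<` [set` c j]).

Definition max_chain (P : ideal R -> Prop) (n : nat) : Prop :=
  strict_chain P n /\ ~ strict_chain P n.+1.

(* The submodules of R/S correspond to the ideals of R that contain S. *)
Definition quotient_length S (l : nat) : Prop :=
  max_chain (fun J => S `<=` [set` J]) l.

Definition ideal_power I (n : nat) : set R :=
  ideal_gen [set x | exists2 y : 'I_n -> R,
                       forall i, y i \in I & x = \prod_(i < n) y i].

End Ideals.

Definition noetherian (R : comNzRingType) : Prop :=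
  forall J : ideal R, exists s : seq R, [set` J] = ideal_gen [set` s].

Definition krull_dim (R : comNzRingType) (d : nat) : Prop :=
  max_chain (@prime_ideal R) d.

(* With d = dim R and P the Hilbert-Samuel polynomial, of degree d and such that
   P(n) = length(R/m^n) for n >> 0, the multiplicity is d! times the leading
   coefficient of P. *)
Definition multiplicity (R : comNzRingType) (m : ideal R) (e : nat) : Prop :=
  exists (d : nat) (P : {poly rat}),
    [/\ krull_dim R d,
        size P = d.+1,
        exists n0 : nat, forall n, (n0 <= n)%N ->
          exists2 l, quotient_length (ideal_power m n) l & P.[n%:R] = l%:R
      & e%:R = d`!%:R * lead_coef P].

Section TraceFitting.
Context {R : comNzRingType}.

Definition trace (M : lmodType R) : set R :=
  [set x | exists n (f : 'I_n -> {linear M -> R^o}) (v : 'I_n -> M),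
             x = \sum_(i < n) f i (v i)].

Definition trace_ideal (I : ideal R) : Prop :=
  exists M : lmodType R, [set` I] = trace M.

Definition is_minor (t n r : nat) (A : 'M[R]_(n, r)) (x : R) : Prop :=
  exists (f : 'I_t -> 'I_n) (g : 'I_t -> 'I_r),
    [/\ forall i j : 'I_t, (i < j)%N -> (f i < f j)%N,
        forall i j : 'I_t, (i < j)%N -> (g i < g j)%N
      & x = \det (mxsub f g A)].

(* The only 0-minor is 1, so that minors_ideal 0 A is the unit ideal. *)
Definition minors_ideal (t n r : nat) (A : 'M[R]_(n, r)) : set R :=
  ideal_gen [set x | is_minor t A x].

(* R^n -> R^r -> M -> 0 is exact, where A acts on row vectors from the right. *)
Definition presents (M : lmodType R) (n r : nat) (A : 'M[R]_(n, r)) : Prop :=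
  exists2 phi : {linear 'rV[R]_r -> M},
    forall y, exists v, phi v = y &
    forall v, phi v = 0 <-> exists w : 'rV[R]_n, v = w *m A.

(* A chosen presentation is used (set0 is a dummy value when M has none). The
   subtraction is truncated, and so I_{r-j}(A) = R whenever r <= j. *)
Definition fitting_ideal (j : nat) (M : lmodType R) : set R :=
  xget set0 [set J | exists n r (A : 'M[R]_(n, r)),
                       presents M A /\ J = minors_ideal (r - j) A].

End TraceFitting.

(* Main.v *)
Require Import Defs.
From HB Require Import structures.
From mathcomp Require Import all_boot all_order all_fingroup all_algebra.
From mathcomp Require Import boolp classical_sets functions cardinality.
From mathcomp Require Import ring zify.

(** The first Fitting ideal of I equals its trace, and an ideal is a trace ideal
    exactly when it is equal to its own trace ([trace_idealP]); this gives the
    equivalence. For I = (a, b) with a nonzero, the first equality is visible in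
    the presentation with two generators: the entries of the relations
    p a + q b = 0 generate (a : b) + (b : a), while the maps from I to R are the
    multiplications by q/a with q in (a : b), so that the trace is
    (q + (b/a) q) = (a : b) + (b : a) as well.

    The Fitting ideal is computed from an arbitrary presentation
    R^n -> R^(r+1) -> I, with generators a_c. Its r-minors lie in the trace
    since, for r relations, the vector of signed minors is proportional to (a_c),
    hence is the image of (a_c) under a linear map I -> R
    ([max_minor_proportional], [minor_trace]). Conversely, as soon as two of the
    a_c generate I, every value h(a_c) is a combination of minors of explicit
    relations ([hom_gen_minors]), and minors of combinations of the rows belong to
    the ideal of minors ([det_mulmx_minors]).

    What remains is that multiplicity 2 makes I/mI at most two-dimensional, for
    every nonzero ideal I ([ideal_length_le2]); Nakayama's lemma then picks two
    generators from any generating family ([generating_pair]). For large n the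
    colength of m^n is 2n + c, so m^n/m^(n+1) has dimension at most 2, and an
    elementary argument on the bilinear maps m x m^n -> m^(n+1)/m^(n+2) produces x
    in m with x m^n = m^(n+1) ([pairing_length_le2], [reduction_exists]). If I/mI
    had dimension at least 3, the chains from x I to I of length 3, multiplied by
    powers of x, would give chains of length 3k above x^k I; but x^k I contains
    some m^(t+k), of colength 2k + constant, which is absurd for large k. *)

Set Implicit Arguments.
Unset Strict Implicit.
Unset Printing Implicit Defensive.

Import Order.TTheory GRing.Theory Num.Theory.

Local Open Scope classical_set_scope.
Local Open Scope ring_scope.

(** * Ideals as sets *)

Section IdealSets.
Context {R : comNzRingType}.
Implicit Types (S T : set R) (J : ideal R).

Definition is_ideal S : Prop :=
  [/\ S 0, forall x y, S x -> S y -> S (x + y) & forall a x, S x -> S (a * x)].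

Lemma ideal_is_ideal J : is_ideal [set` J].
Proof.
split=> [|x y|a x] /=; first exact: rpred0.
- exact: rpredD.
- exact: (@rpredZ _ _ J a x).
Qed.

(** Lets colon ideals, unions of chains, traces and the like, which arise as
    Prop-valued sets, be fed to hypotheses that quantify over bundled ideals. *)
Lemma is_ideal_ideal S : is_ideal S -> exists J, [set` J] = S.
Proof.
case=> S0 SD SZ; pose p : {pred R^o} := fun x => `[< S x >].
have pP : GRing.submod_closed p.
  split; first by rewrite unfold_in; apply/asboolP.
  move=> a x y; rewrite !unfold_in => /asboolP Sx /asboolP Sy.
  by apply/asboolP; apply: SD => //; apply: SZ.
pose H := GRing.isSubmodClosed.Build R R^o p pP.
pose J : ideal R := HB.pack p H.
by exists J; apply/predeqP => x; split=> /asboolP.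
Qed.

Lemma zero_is_ideal : is_ideal [set (0 : R)].
Proof. by split=> // [x y -> ->|a x ->]; [exact: addr0|exact: mulr0]. Qed.

Lemma is_idealB S x y : is_ideal S -> S x -> S y -> S (x - y).
Proof. by case=> _ SD SZ Sx Sy; apply: SD => //; rewrite -mulN1r; apply: SZ. Qed.

Lemma is_ideal_sum S (T : finType) (f : T -> R) :
  is_ideal S -> (forall i, S (f i)) -> S (\sum_i f i).
Proof. by move=> [S0 SD _] Sf; elim/big_ind: _ => //; apply: SD. Qed.

Lemma ideal_gen_is_ideal S : is_ideal (ideal_gen S).
Proof.
split=> [|x y Sx Sy|a x Sx] J SJ; have [J0 JD JZ] := ideal_is_ideal J.
- exact: J0.
- by apply: JD; [exact: Sx|exact: Sy].
- by apply: JZ; exact: Sx.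
Qed.

Lemma sub_ideal_gen S : S `<=` ideal_gen S.
Proof. by move=> x Sx J; apply. Qed.

Lemma ideal_gen_sub S T : is_ideal T -> S `<=` T -> ideal_gen S `<=` T.
Proof. by move=> /is_ideal_ideal[J <-] ST x; apply. Qed.

(** The ideal S + Ra, with the S-component eliminated. *)
Definition adj S a : set R := [set x | exists r, S (x - r * a)].

Lemma adj_is_ideal S a : is_ideal S -> is_ideal (adj S a).
Proof.
move=> [S0 SD SZ]; split=> [|x y [r Sx] [s Sy]|b x [r Sx]].
- by exists 0; rewrite mul0r subr0.
- by exists (r + s); rewrite mulrDl opprD addrACA; apply: SD.
- by exists (b * r); rewrite -mulrA -mulrBr; apply: SZ.
Qed.

Lemma sub_adj S a : S `<=` adj S a.
Proof. by move=> x Sx; exists 0; rewrite mul0r subr0. Qed.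

Lemma adj_mem S a : S 0 -> adj S a a.
Proof. by move=> S0; exists 1; rewrite mul1r subrr. Qed.

Lemma adj_sub S a T : is_ideal T -> S `<=` T -> T a -> adj S a `<=` T.
Proof.
move=> [_ TD TZ] ST Ta x [r /ST Tx].
by rewrite -(subrK (r * a) x); apply: TD => //; apply: TZ.
Qed.

Definition scale x S : set R := [set x * y | y in S].

Lemma scale_is_ideal x S : is_ideal S -> is_ideal (scale x S).
Proof.
move=> [S0 SD SZ]; split=> [|_ _ [y Sy <-] [z Sz <-]|a _ [y Sy <-]].
- by exists 0 => //; rewrite mulr0.
- by exists (y + z); [exact: SD|rewrite mulrDr].
- by exists (a * y); [exact: SZ|rewrite mulrCA].
Qed.

Lemma scaleS x S T : S `<=` T -> scale x S `<=` scale x T.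
Proof. by move=> ST _ [y /ST Ty <-]; exists y. Qed.

Lemma scale_comp x y S : scale x (scale y S) = scale (x * y) S.
Proof.
apply/seteqP; split=> [_ [_ [z Sz <-] <-]|_ [z Sz <-]].
  by exists z; rewrite ?mulrA.
by exists (y * z); [exists z|rewrite mulrA].
Qed.

Lemma scale1 S : scale 1 S = S.
Proof.
apply/seteqP; split=> [_ [z Sz <-]|z Sz]; first by rewrite mul1r.
by exists z; rewrite ?mul1r.
Qed.

Definition mulset S T : set R :=
  ideal_gen [set z | exists x y, [/\ S x, T y & z = x * y]].

Lemma mulset_is_ideal S T : is_ideal (mulset S T).
Proof. exact: ideal_gen_is_ideal. Qed.

Lemma mulset_mem S T x y : S x -> T y -> mulset S T (x * y).
Proof. by move=> Sx Ty; apply: sub_ideal_gen; exists x, y. Qed.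

Lemma mulset_sub S T U : is_ideal U -> (forall x y, S x -> T y -> U (x * y)) ->
  mulset S T `<=` U.
Proof.
by move=> idU STU; apply: ideal_gen_sub => // _ [x [y [Sx Ty ->]]]; apply: STU.
Qed.

Lemma mulset_subr S T : is_ideal T -> mulset S T `<=` T.
Proof. by move=> idT; apply: mulset_sub => // x y _; case: idT => _ _; apply. Qed.

(** * Chains of ideals and lengths *)

Lemma strict_chainW (P : ideal R -> Prop) n n' :
  (n' <= n)%N -> strict_chain P n -> strict_chain P n'.
Proof.
move=> le_n [c [Pc lt_c]]; have le' : (n'.+1 <= n.+1)%N by [].
by exists (fun i => c (widen_ord le' i)); split=> [i|i j ij]; [exact: Pc|exact: lt_c].
Qed.

Lemma max_chain_leq (P : ideal R -> Prop) n l :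
  strict_chain P n -> max_chain P l -> (n <= l)%N.
Proof.
move=> Pn [_ nPl]; rewrite leqNgt; apply/negP => lt_l.
exact: nPl (strict_chainW lt_l Pn).
Qed.

Lemma max_chain_uniq (P : ideal R -> Prop) n l :
  max_chain P n -> max_chain P l -> n = l.
Proof.
move=> Pn Pl; apply/eqP; rewrite eqn_leq.
by rewrite (max_chain_leq Pn.1 Pl) (max_chain_leq Pl.1 Pn).
Qed.

Definition chain_above S n := strict_chain (fun J => S `<=` [set` J]) n.

Lemma chain_above_sub S T n : S `<=` T -> chain_above T n -> chain_above S n.
Proof.
move=> ST [c [Tc lt_c]]; exists c; split=> // i.
exact: subset_trans ST (Tc i).
Qed.

Lemma chain_above0 S : is_ideal S -> chain_above S 0.
Proof.
move=> /is_ideal_ideal[J <-]; exists (fun=> J); split=> [i|i j]; first by [].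
by rewrite !ord1.
Qed.

Lemma chain_above_cons S T n : is_ideal S -> S `<` T -> chain_above T n ->
  chain_above S n.+1.
Proof.
move=> /is_ideal_ideal[J <-] ltJ [c [Tc lt_c]].
have ltJc i : [set` J] `<` [set` c i].
  split; first exact: subset_trans ltJ.1 (Tc i).
  by move=> cJ; apply: ltJ.2; apply: subset_trans (Tc i) cJ.
exists (fun i => if unlift ord0 i is Some j then c j else J); split=> [i|i j].
  by case: unliftP => [j|] _ //; have [] := ltJc j.
case: (unliftP ord0 i) => [i'|] ->; case: (unliftP ord0 j) => [j'|] -> //.
  by rewrite /= /bump /= !add1n ltnS; apply: lt_c.
Qed.

Lemma chain_above3 S K1 K2 T n :
    is_ideal S -> is_ideal K1 -> is_ideal K2 ->
    S `<` K1 -> K1 `<` K2 -> K2 `<` T -> chain_above T n ->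
  chain_above S n.+3.
Proof.
by move=> idS id1 id2 S1 S2 S3 /(chain_above_cons id2 S3) /(chain_above_cons id1 S2)
  /(chain_above_cons idS S1).
Qed.

(** For S containing m T this says that T/S has dimension at most 2 over the
    residue field, phrased by two steps of a greedy choice of generators so that
    no quotient module has to be formed. *)
Definition length_le2 S T : Prop :=
  forall u v, T u -> ~ S u -> T v -> ~ adj S u v -> T `<=` adj (adj S u) v.

(** A greedy choice u, v that fails to generate T gives the chain
    S < S + Ru < S + Ru + Rv < T. *)
Lemma length_le2P S T : is_ideal S -> is_ideal T -> S `<=` T ->
  (forall K1 K2, is_ideal K1 -> is_ideal K2 -> S `<` K1 -> K1 `<` K2 ->
     K2 `<` T -> False) -> length_le2 S T.
Proof.
move=> idS idT ST no3 u v Tu Su Tv Sv; apply: contrapT => nT.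
have S0 : S 0 by case: idS.
have id1 := adj_is_ideal u idS; have id2 := adj_is_ideal v id1.
have T1 := adj_sub idT ST Tu.
have mu := adj_mem u S0.
have mv : adj (adj S u) v v by apply: adj_mem; case: id1.
apply: (no3 _ _ id1 id2).
- by split; [exact: sub_adj|move=> /(_ _ mu)].
- by split; [exact: sub_adj|move=> /(_ _ mv)].
- by split=> //; exact: adj_sub.
Qed.

(** * Noetherian rings *)

Lemma noetherian_chain (noethR : noetherian R) (J : nat -> set R) :
  (forall n, is_ideal (J n)) -> (forall n, J n `<=` J n.+1) ->
  exists n, J n.+1 `<=` J n.
Proof.
move=> idJ leJ.
have mono n p : (n <= p)%N -> J n `<=` J p.
  move=> /subnK <-; elim: (p - n)%N => [//|k IHk].
  exact: subset_trans IHk (leJ _).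
pose U : set R := [set x | exists n, J n x].
have idU : is_ideal U.
  split=> [|x y [n Jx] [p Jy]|a x [n Jx]].
  - by exists 0%N; case: (idJ 0%N).
  - exists (maxn n p); case: (idJ (maxn n p)) => _ + _; apply.
      exact: mono (leq_maxl _ _) _ Jx.
    exact: mono (leq_maxr _ _) _ Jy.
  - by exists n; case: (idJ n) => _ _; apply.
have [K KU] := is_ideal_ideal idU; have [s] := noethR K; rewrite KU => Us.
have [n Jn] : exists n, [set` s] `<=` J n.
  have: [set` s] `<=` U by rewrite Us; apply: sub_ideal_gen.
  elim: s {Us} => [_|x s IHs sU]; first by exists 0%N => x.
  have [|n sn] := IHs; first by move=> y ys; apply: sU; rewrite /= inE ys orbT.
  have [|p Jx] := sU x; first by rewrite /= inE eqxx.
  exists (maxn n p) => y /=; rewrite inE => /predU1P[->|ys].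
    exact: mono (leq_maxr _ _) _ Jx.
  exact: mono (leq_maxl _ _) _ (sn _ ys).
exists n => x Jx; suff : U `<=` J n by apply; exists n.+1.
by rewrite Us; apply: ideal_gen_sub.
Qed.

(** If no ideal were maximal among those with P, dependent choice would produce
    an infinite strictly ascending chain. *)
Lemma noetherian_maximal (noethR : noetherian R) (P : set R -> Prop) S :
  is_ideal S -> P S ->
  exists T, [/\ is_ideal T, S `<=` T, P T &
    forall T', is_ideal T' -> P T' -> T `<=` T' -> T' `<=` T].
Proof.
move=> idS PS; apply: contrapT => nmax.
pose A := {T : set R | [/\ is_ideal T, S `<=` T & P T]}.
have step (T : A) : exists T' : A, sval T `<` sval T'.
  case: T => T [idT ST PT]; apply: contrapT => noT'; apply: nmax; exists T.
  split=> // T' idT' PT' TT'; apply: contrapT => nT'; apply: noT'.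
  have pf : [/\ is_ideal T', S `<=` T' & P T'].
    by split=> //; apply: subset_trans TT'.
  by exists (exist _ T' pf).
have [next nextP] := choice step.
have SP : [/\ is_ideal S, S `<=` S & P S] by split.
pose A0 : A := exist _ S SP.
have [||n] := @noetherian_chain noethR (fun n => sval (iter n next A0)).
- by move=> n; case: (svalP (iter n next A0)).
- by move=> n /=; case: (nextP (iter n next A0)).
- by move=> sub; have [_] := nextP (iter n next A0); apply.
Qed.

End IdealSets.


(** * Local rings: Nakayama's lemma *)

Section Local.
Context {R : comNzRingType} (m : ideal R).
Hypotheses (noethR : noetherian R) (localR : local_ring m).
Implicit Types (S T : set R) (J : ideal R).

Lemma local_proper : 1 \notin m.
Proof.
apply/negP => m1; have [[mT _] _] := localR; move/eqP: mT; apply.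
apply/seteqP; split=> // x _ /=.
by rewrite -(mulr1 x); case: (ideal_is_ideal m) => _ _; apply.
Qed.

(** An ideal maximal among the proper ideals containing x is a maximal ideal,
    so it is m. *)
Lemma local_unit x : x \notin m -> exists y, y * x = 1.
Proof.
move=> xm; apply: contrapT => nx.
have id0 := @zero_is_ideal R.
pose P S := ~ S 1.
have P0 : P (adj [set 0] x).
  by move=> [r /eqP]; rewrite subr_eq0 => /eqP r1; apply: nx; exists r.
have [T [idT xT PT maxT]] := noetherian_maximal noethR (adj_is_ideal x id0) P0.
have [J JT] := is_ideal_ideal idT.
have maxJ : maximal_ideal J.
  split=> [|J' JJ']; first by rewrite JT; apply/eqP => T1; apply: PT; rewrite T1.
  have [J'1|nJ'1] := pselect ([set` J'] 1); [right|left].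
    apply/seteqP; split=> // y _ /=.
    by rewrite -(mulr1 y); case: (ideal_is_ideal J') => _ _; apply.
  apply/seteqP; split=> //; rewrite JT in JJ' *.
  exact: maxT (ideal_is_ideal J') nJ'1 JJ'.
have [_ /(_ _ maxJ) Jm] := localR.
have mx : [set` m] x by rewrite -Jm JT; exact/xT/adj_mem.
by case/negP: xm.
Qed.

(** Otherwise take L maximal among the ideals containing K but not N. For n in N
    and r in m with rn outside L, the ideal L + R(rn) contains N, so n lies in
    L + R(rn); as 1 - sr is a unit this forces n, hence rn, into L. Thus m N is
    contained in L, and then so is N. *)
Lemma nakayama (K N : set R) : is_ideal K -> is_ideal N ->
  N `<=` ideal_gen (K `|` mulset [set` m] N) -> N `<=` K.
Proof.
move=> idK idN NK; apply: contrapT => nNK.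
have [L [idL KL nNL maxL]] :=
  @noetherian_maximal _ noethR (fun S => ~ (N `<=` S)) K idK nNK.
apply: nNL; apply: (subset_trans NK); apply: ideal_gen_sub => // x [/KL //|].
apply: mulset_sub x => // r n mr Nn; have [L0 LD LZ] := idL.
have [Ln|nLn] := pselect (L n); first exact: LZ.
have idL' := adj_is_ideal (r * n) idL.
have L'rn : adj L (r * n) (r * n) by exact: adj_mem.
have [NL'|nNL'] := pselect (N `<=` adj L (r * n)); last first.
  exact: (maxL _ idL' nNL' (@sub_adj _ L _) _ L'rn).
have [s Ln] := NL' _ Nn; case: nLn.
have /local_unit[u u1] : 1 - s * r \notin m.
  apply/negP => m1; move/negP: local_proper; apply.
  rewrite -(subrK (s * r) 1); have [_ mD mZ] := ideal_is_ideal m.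
  by apply: mD => //; apply: mZ.
have -> : n = u * (n - s * (r * n)) by rewrite -[LHS]mul1r -u1; ring.
exact: LZ.
Qed.

Lemma nakayama0 (N : set R) : is_ideal N -> N `<=` mulset [set` m] N -> N `<=` [set 0].
Proof.
move=> idN NmN; apply: nakayama => //; first exact: zero_is_ideal.
by apply: subset_trans NmN _ => x mx; apply: sub_ideal_gen; right.
Qed.

Lemma nakayama_adj2 (I : set R) u v : is_ideal I -> I u -> I v ->
  I `<=` adj (adj (mulset [set` m] I) u) v -> I `<=` adj (adj [set 0] u) v.
Proof.
move=> idI Iu Iv sI.
have id0 := @zero_is_ideal R.
have id1 := adj_is_ideal u id0; have id2 := adj_is_ideal v id1.
apply: nakayama => //; apply: (subset_trans sI).
apply: adj_sub; first exact: ideal_gen_is_ideal.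
  apply: adj_sub; first exact: ideal_gen_is_ideal.
    by move=> x mx; apply: sub_ideal_gen; right.
  by apply: sub_ideal_gen; left; apply/sub_adj/adj_mem.
by apply: sub_ideal_gen; left; apply: adj_mem; case: id1.
Qed.

(** * Powers of the maximal ideal and the Hilbert function *)

Notation M := (ideal_power m).

Lemma ideal_power_is_ideal n : is_ideal (M n).
Proof. exact: ideal_gen_is_ideal. Qed.

(** For the inclusion of m m^n, the elements y with xy in m^(n+1) form an ideal,
    so it suffices to test products of n elements of m. *)
Lemma ideal_powerS n : M n.+1 = mulset [set` m] (M n).
Proof.
apply/seteqP; split.
  apply: ideal_gen_sub (mulset_is_ideal _ _) _ => _ [y my ->].
  rewrite big_ord_recl; apply: mulset_mem; first exact: my.
  by apply: sub_ideal_gen; exists (fun i => y (lift ord0 i)).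
apply: mulset_sub (ideal_power_is_ideal _) _ => x y mx.
have [M0 MD MZ] := ideal_power_is_ideal n.+1.
pose T := [set y | M n.+1 (x * y)].
apply: (@ideal_gen_sub _ _ T) y => [|_ [y my ->]].
  split=> [|y z|a y]; rewrite /T /= ?mulr0 //; first by rewrite mulrDr; apply: MD.
  by rewrite mulrCA; apply: MZ.
apply: sub_ideal_gen.
exists (fun i => if unlift ord0 i is Some j then y j else x).
  by move=> i; case: unliftP.
rewrite big_ord_recl unlift_none; congr (_ * _).
by apply: eq_bigr => i _; rewrite liftK.
Qed.

Lemma ideal_power_decr n k : M (n + k) `<=` M n.
Proof.
elim: k => [|k IHk]; first by rewrite addn0.
rewrite addnS ideal_powerS; apply: subset_trans IHk.
by apply: mulset_subr; apply: ideal_power_is_ideal.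
Qed.

Lemma ideal_power_exp x n : x \in m -> M n (x ^+ n).
Proof.
move=> mx; elim: n => [|n IHn]; last by rewrite ideal_powerS exprS; apply: mulset_mem.
apply: sub_ideal_gen; exists (fun=> 0) => [i|]; last by rewrite big_ord0.
by case: i.
Qed.

(** The Hilbert-Samuel polynomial is eX + c. Writing its values from n0 on as
    l0 + e k keeps the possibly negative c out of the natural numbers. *)
Lemma multiplicity_chain (e : nat) :
  krull_dim R 1 -> multiplicity m e ->
  exists n0 l0 : nat, forall k, quotient_length (M (n0 + k)) (l0 + e * k).
Proof.
move=> dim1 [d [P [dimd sizeP [n0 lenP] eP]]].
have d1 : d = 1%N := max_chain_uniq dimd dim1; rewrite {}d1 in sizeP eP *.
have P1 : P`_1 = e%:R by rewrite eP /lead_coef sizeP mul1r.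
have hP (n : nat) : P.[n%:R] = P`_0 + (e * n)%:R.
  by rewrite horner_coef sizeP big_ord_recl big_ord1 expr0 mulr1 P1 natrM.
have [l0 _ l0P] := lenP _ (leqnn n0).
exists n0, l0 => k; have [l lenl lP] := lenP _ (leq_addr k n0).
suff <- : l = (l0 + e * k)%N by [].
apply/eqP; rewrite -(eqr_nat rat) natrD -lP -l0P !hP mulnDr natrD.
by rewrite addrA.
Qed.
End Local.


(** * Existence of a reduction *)

Section Pairing.
Context {R : comNzRingType} (m : ideal R).
Hypotheses (noethR : noetherian R) (localR : local_ring m).
Implicit Types (S T : set R).
Notation M := (ideal_power m).

Lemma ideal_genU S T x : is_ideal S -> is_ideal T -> ideal_gen (S `|` T) x ->
  exists2 s, S s & T (x - s).
Proof.
move=> [S0 SD SZ] [T0 TD TZ].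
apply: (@ideal_gen_sub _ _ [set x | exists2 s, S s & T (x - s)]) x.
  split=> [|x y [s Ss Ts] [t St Tt]|a x [s Ss Ts]].
  - by exists 0; rewrite ?subr0.
  - by exists (s + t); [exact: SD|rewrite opprD addrACA; exact: TD].
  - by exists (a * s); [exact: SZ|rewrite -mulrBr; exact: TZ].
move=> x [Sx|Tx]; first by exists x; rewrite ?subrr.
by exists 0; rewrite ?subr0.
Qed.

(** Modulo N the vectors u, v over the residue field are independent, so that
    their lines meet only in 0. *)
Lemma adj_independent N u v t : is_ideal N -> (forall r, r \in m -> N (r * v)) ->
  ~ adj N u v -> adj N u t -> adj N v t -> N t.
Proof.
move=> idN mv nuv [a Na] [b Nb]; have [_ ND NZ] := idN.
have [bm|] := boolP (b \in m).
  by rewrite -(subrK (b * v) t); apply: ND => //; apply: mv.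
move=> /(local_unit noethR localR)[c c1]; case: nuv; exists (c * a).
have -> : v - c * a * u = c * (t - a * u) - c * (t - b * v).
  by rewrite -[v in LHS]mul1r -c1; ring.
by apply: is_idealB => //; apply: NZ.
Qed.

(** A fact from linear algebra over the residue field: if the image of a bilinear
    map on V x W spans a space U/N of dimension at most 2, then some v W or some
    V w already spans it. Otherwise every v W and every V w is at most a line.
    Take v1 w1 nonzero and v2 w2 outside its line. Then v1 w2 lies on the line of
    v1 w1 (both are in v1 W) and on that of v2 w2 (both are in V w2), so it
    vanishes, and so does v2 w1. Hence v1 + v2 maps w1, w2 to the independent
    vectors v1 w1, v2 w2, a contradiction. *)
Lemma pairing_length_le2 (V W U N : set R) :
    is_ideal V -> is_ideal W -> is_ideal N -> U = mulset V W ->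
    mulset [set` m] U `<=` N -> length_le2 N U ->
  (exists2 v, V v & U `<=` ideal_gen (scale v W `|` N)) \/
  (exists2 w, W w & U `<=` ideal_gen (scale w V `|` N)).
Proof.
move=> idV idW idN -> mN len2; apply: contrapT => /not_orP[nV nW].
have [N0 ND NZ] := idN.
have subN (S : set R) u v : N `<=` S -> is_ideal S -> S u -> S v ->
    adj (adj N u) v `<=` S.
  by move=> NS idS Su Sv; do 2?apply: adj_sub => //.
have hV v w w' : V v -> W w -> W w' -> ~ N (v * w) -> adj N (v * w) (v * w').
  move=> Vv Ww Ww' nN; apply: contrapT => nadj; apply: nV; exists v => //.
  apply: subset_trans (len2 _ _ _ nN _ nadj) _; try exact: mulset_mem.
  apply: subN; [|exact: ideal_gen_is_ideal| |].
  - by move=> x Nx; apply: sub_ideal_gen; right.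
  - by apply: sub_ideal_gen; left; exists w.
  - by apply: sub_ideal_gen; left; exists w'.
have hW w v v' : W w -> V v -> V v' -> ~ N (v * w) -> adj N (v * w) (v' * w).
  move=> Ww Vv Vv' nN; apply: contrapT => nadj; apply: nW; exists w => //.
  apply: subset_trans (len2 _ _ _ nN _ nadj) _; try exact: mulset_mem.
  apply: subN; [|exact: ideal_gen_is_ideal| |].
  - by move=> x Nx; apply: sub_ideal_gen; right.
  - by apply: sub_ideal_gen; left; exists v; rewrite // mulrC.
  - by apply: sub_ideal_gen; left; exists v'; rewrite // mulrC.
have [v1 [w1 [Vv1 Ww1 nu1]]] : exists v w, [/\ V v, W w & ~ N (v * w)].
  apply: contrapT => nvw; apply: nV; exists 0; first by case: idV.
  have sN : mulset V W `<=` N.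
    apply: mulset_sub => // v w Vv Ww; apply: contrapT => nN.
    by apply: nvw; exists v, w.
  by move=> x /sN Nx; apply: sub_ideal_gen; right.
have [v2 [w2 [Vv2 Ww2 nu2]]] :
    exists v w, [/\ V v, W w & ~ adj N (v1 * w1) (v * w)].
  apply: contrapT => nvw; apply: nV; exists v1 => //.
  have sN : mulset V W `<=` adj N (v1 * w1).
    apply: mulset_sub (adj_is_ideal _ idN) _ => v w Vv Ww.
    by apply: contrapT => nN; apply: nvw; exists v, w.
  apply: subset_trans sN _; apply: adj_sub; first exact: ideal_gen_is_ideal.
    by move=> x Nx; apply: sub_ideal_gen; right.
  by apply: sub_ideal_gen; left; exists w1.
have nu2' : ~ N (v2 * w2) by move=> /sub_adj.
have cross t : adj N (v1 * w1) t -> adj N (v2 * w2) t -> N t.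
  apply: adj_independent => // r mr; apply: mN; apply: mulset_mem => //.
  exact: mulset_mem.
have N12 : N (v1 * w2) by apply: cross; [exact: hV|exact: hW].
have N21 : N (v2 * w1) by apply: cross; [exact: hW|exact: hV].
have [_ VD _] := idV.
have nv : ~ N ((v1 + v2) * w1).
  move=> Nv; apply: nu1; have -> : v1 * w1 = (v1 + v2) * w1 - v2 * w1 by ring.
  exact: is_idealB.
have [r Nr] := hV _ _ _ (VD _ _ Vv1 Vv2) Ww1 Ww2 nv.
apply: nu2; exists r.
have -> : v2 * w2 - r * (v1 * w1) =
  ((v1 + v2) * w2 - r * ((v1 + v2) * w1)) - (v1 * w2 - r * (v2 * w1)) by ring.
by apply: is_idealB => //; apply: is_idealB => //; apply: NZ.
Qed.

(** The pairing lemma applies to m x m^p -> m^(p+1)/m^(p+2). If it yields x in m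
    with x m^p + m^(p+2) = m^(p+1), Nakayama's lemma concludes. Otherwise, for two
    consecutive exponents, m z and m z' span m^(p+1)/m^(p+2) and
    m^(p+2)/m^(p+3), with z' in m^(p+1). Then z' = x z modulo m^(p+2) with x in m, so
    m z' = x m z is contained in x m^(p+1) modulo m^(p+3), and x works for p+1. *)
Lemma reduction_exists n :
    (forall k, (n < k)%N -> length_le2 (M k.+1) (M k)) ->
  exists x p, [/\ x \in m, (n <= p)%N & M p.+1 `<=` scale x (M p)].
Proof.
move=> len2.
pose good p x := x \in m /\ M p.+1 `<=` scale x (M p).
have idM := @ideal_power_is_ideal R m.
have pairing p : (n <= p)%N -> (exists x, good p x) \/
    exists2 z, M p z & M p.+1 `<=` ideal_gen (scale z [set` m] `|` M p.+2).
  move=> le_np; have := @pairing_length_le2 [set` m] (M p) (M p.+1) (M p.+2)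
    (ideal_is_ideal m) (idM p) (idM _) (ideal_powerS m p).
  rewrite [M p.+2]ideal_powerS; case=> //; rewrite -ideal_powerS.
    by apply: len2.
    move=> [x mx sM]; left; exists x; split=> //.
    apply: (nakayama noethR localR) => //; first exact: scale_is_ideal.
    by rewrite -ideal_powerS.
  by move=> [z Mz sM]; right; exists z.
have [[x [mx sM]]|[z Mz sM]] := pairing n (leqnn n); first by exists x, n.
have [[x [mx sM']]|[z' Mz' sM']] := pairing n.+1 (leqnSn n).
  by exists x, n.+1.
have [] := @ideal_genU (scale z [set` m]) (M n.+2) z' _ _ (sM _ Mz').
- exact/scale_is_ideal/ideal_is_ideal.
- exact: idM.
move=> _ [x mx <-] Mt; exists x, n.+1; split=> //.
apply: (nakayama noethR localR) => //; first exact: scale_is_ideal.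
rewrite -ideal_powerS; apply: subset_trans sM' _.
apply: ideal_gen_sub; first exact: ideal_gen_is_ideal.
move=> y [[r mr <-]|My]; last by apply: sub_ideal_gen; right.
have [_ GD _] := ideal_gen_is_ideal (scale x (M n.+1) `|` M n.+3).
have -> : z' * r = r * (z' - z * x) + x * (r * z) by ring.
apply: GD; apply: sub_ideal_gen; [right|left].
  by rewrite ideal_powerS; apply: mulset_mem.
by exists (r * z) => //; rewrite ideal_powerS; apply: mulset_mem.
Qed.

Lemma reduction_shift x n k j :
  M n.+1 `<=` scale x (M n) -> M (n + k + j) `<=` scale (x ^+ j) (M (n + k)).
Proof.
move=> red; have redS p : (n <= p)%N -> M p.+1 `<=` scale x (M p).
  move=> /subnK <-; elim: (p - n)%N => [//|i IHi].
  rewrite ideal_powerS; apply: mulset_sub.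
    exact/scale_is_ideal/ideal_power_is_ideal.
  move=> r y mr /IHi[z Mz <-]; exists (r * z); last by rewrite mulrCA.
  by rewrite addSn ideal_powerS; apply: mulset_mem.
elim: j => [|j IHj]; first by rewrite addn0 expr0 scale1.
rewrite addnS exprS -scale_comp.
apply: subset_trans (redS _ _) (scaleS IHj).
by rewrite -addnA leq_addr.
Qed.
End Pairing.

(** * Ideals are generated by two elements *)

Section Domain.
Context {R : idomainType} (m : ideal R).
Hypotheses (noethR : noetherian R) (localR : local_ring m).
Hypothesis (dimR : krull_dim R 1).
Notation M := (ideal_power m).

Lemma scale_proper (x : R) (S T : set R) : x != 0 -> S `<` T ->
  scale x S `<` scale x T.
Proof.
move=> x0 [ST nTS]; split; first exact: scaleS.
move=> sTS; apply: nTS => y Ty.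
by have [|z Sz /(mulfI x0) <-] := sTS (x * y); first by exists y.
Qed.

Lemma proper_sub_max (J : ideal R) : 1 \notin J -> [set` J] `<=` [set` m].
Proof.
move=> J1 x /= Jx; apply: contraNT J1 => /(local_unit noethR localR)[y <-].
by case: (ideal_is_ideal J) => _ _; apply.
Qed.

Lemma maximal_neq0 : exists2 x, x \in m & x != 0.
Proof.
have [[c [prime_c lt_c]] _] := dimR.
have [_ nsub] := lt_c ord0 (lift ord0 ord0) isT.
have [x cx ncx] : exists2 x, x \in c (lift ord0 ord0) & x \notin c ord0.
  apply: contrapT => nx; apply: nsub => x /= cx; apply: contraPT nx => ncx.
  by apply; exists x.
have [c1 _] := prime_c (lift ord0 ord0).
exists x; first exact: (proper_sub_max c1).
by apply: contraNneq ncx => ->; apply: rpred0.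
Qed.

(** An ideal maximal among those containing I and no power of x is prime. It is
    nonzero and differs from m, so 0 < J < m would be too long a chain of primes. *)
Lemma exp_mem_ideal (I : set R) x : is_ideal I -> (exists2 a, I a & a != 0) ->
  x \in m -> exists s, I (x ^+ s).
Proof.
move=> idI [a Ia a0] mx; apply: contrapT => nI.
have [T [idT IT PT maxT]] := noetherian_maximal noethR
  (P := fun S => ~ exists s, S (x ^+ s)) idI nI.
have [J JT] := is_ideal_ideal idT.
have JE y : (y \in J) = (T y) :> Prop by rewrite -JT.
have prime_m : prime_ideal m.
  split=> [|y z myz]; first exact: local_proper localR.
  have [ym|] := boolP (y \in m); first by left.
  move=> /(local_unit noethR localR)[u u1]; right.
  rewrite -[z]mul1r -u1 -mulrA.
  by case: (ideal_is_ideal m) => _ _; apply.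
have J1 : 1 \notin J.
  by apply/negP; rewrite JE => T1; apply: PT; exists 0%N; rewrite expr0.
have prime_J : prime_ideal J.
  split=> [|y z]; first by [].
  rewrite !JE => Tyz; apply: contrapT => /not_orP[nTy nTz].
  have [T0 TD TZ] := idT.
  have powT w : ~ T w -> exists s r, T (x ^+ s - r * w).
    move=> nTw; apply: contrapT => nsr; apply: nTw.
    apply: (maxT _ (adj_is_ideal w idT) _ (@sub_adj _ T w)); last exact: adj_mem.
    by move=> [s [r Tr]]; apply: nsr; exists s, r.
  have [s [b Tb]] := powT _ nTy; have [t [c Tc]] := powT _ nTz.
  apply: PT; exists (s + t)%N; rewrite exprD.
  have -> : x ^+ s * x ^+ t = x ^+ t * (x ^+ s - b * y) +
    (b * y * (x ^+ t - c * z) + b * c * (y * z)) by ring.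
  by apply: (TD); [exact: TZ|apply: TD; exact: TZ].
have id0 := @zero_is_ideal R.
have [Z Z0] := is_ideal_ideal id0.
have ZE y : (y \in Z) = (y = 0) :> Prop by rewrite -[RHS]/([set 0] y) -Z0.
have prime_0 : prime_ideal Z.
  split=> [|y z]; first by apply/negP; rewrite ZE => /eqP; rewrite oner_eq0.
  by rewrite !ZE => /eqP; rewrite mulf_eq0 => /orP[] /eqP ->; [left|right].
have ltZJ : [set` Z] `<` [set` J].
  rewrite Z0 JT; split; first by move=> _ ->; case: idT.
  by move=> /(_ _ (IT _ Ia)) /eqP; apply/negP.
have ltJm : [set` J] `<` [set` m].
  split; first exact: proper_sub_max.
  move=> /(_ _ mx); rewrite JT => Tx.
  by apply: PT; exists 1%N; rewrite expr1.
have [_] := dimR; apply.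
exists (fun i : 'I_3 => nth Z [:: Z; J; m] i); split.
  by case=> [[|[|[|]]]].
case=> [[|[|[|]]]] //= _ [[|[|[|]]]] //= _ _.
split; first exact: subset_trans ltZJ.1 ltJm.1.
by move=> mZ; apply: ltJm.2; apply: subset_trans mZ ltZJ.1.
Qed.

Lemma ideal_power_strict n : ~ (M n `<=` M n.+1).
Proof.
rewrite ideal_powerS => sM; have [x mx x0] := maximal_neq0.
have := nakayama0 noethR localR (ideal_power_is_ideal m n) sM.
move=> /(_ _ (ideal_power_exp (n := n) mx)) /eqP.
by apply/negP; rewrite expf_neq0.
Qed.

Hypothesis (multR : multiplicity m 2).

(** Lengths grow too fast otherwise. Let x be a reduction with x m^p = m^(p+1).
    A chain of length 3 from m I to I, scaled by the powers of x, yields chains of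
    length 3k from x^k I to I, since x^(k+1) I is contained in x^k m I. As
    I contains some m^t, the ideal x^k I contains x^k m^t = m^(t+k), whose
    colength is only 2k + constant. The same bound on colengths gives the
    dimension bound for m^k/m^(k+1) on which the existence of x rests. *)
Lemma ideal_length_le2 (I : set R) : is_ideal I -> (exists2 a, I a & a != 0) ->
  length_le2 (mulset [set` m] I) I.
Proof.
move=> idI I0; have [n0 [l0 lenM]] := multiplicity_chain dimR multR.
have idM := @ideal_power_is_ideal R m.
have lenM2 k : (n0 < k)%N -> length_le2 (M k.+1) (M k).
  move=> /ltnW /subnKC <-; set j := (k - n0)%N.
  apply: length_le2P; [exact: idM|exact: idM| |].
    by rewrite -addn1; apply: ideal_power_decr.
  (* A chain of length 3 between m^(k+1) and m^k would extend a maximal chain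
     above m^k, although the colength grows by 2 only. *)
  move=> K1 K2 id1 id2 lt1 lt2 lt3.
  have [len _] := lenM j.
  have len3 := chain_above3 (idM _) id1 id2 lt1 lt2 lt3 len.
  rewrite -addnS in len3; have := max_chain_leq len3 (lenM j.+1).
  by lia.
have [x [p [mx le_p red]]] := reduction_exists noethR localR lenM2.
have x0 : x != 0.
  apply/eqP => x0; apply: (@ideal_power_strict p.+1) => y /red[z _ <-].
  by rewrite x0 mul0r; case: (idM p.+2).
have [s Is] := exp_mem_ideal idI I0 mx.
have [_ ID IZ] := idI.
have MI : M (p + s) `<=` I.
  move=> y; rewrite -[p]addn0 => /(reduction_shift (k := 0) red)[z _ <-].
  by rewrite mulrC; apply: IZ.
apply: length_le2P => //; first exact: mulset_is_ideal.
  exact: mulset_subr.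
move=> K1 K2 id1 id2 lt1 lt2 lt3.
have chainI k : chain_above (scale (x ^+ k) I) (3 * k).
  elim: k => [|k IHk]; first by rewrite expr0 scale1; apply: chain_above0.
  apply: (@chain_above_sub _ _ (scale (x ^+ k) (mulset [set` m] I))).
    rewrite exprSr -scale_comp; apply: scaleS => _ [y Iy <-].
    exact: mulset_mem.
  rewrite mulnS addnC addn3.
  have xk0 : x ^+ k != 0 by rewrite expf_neq0.
  apply: (@chain_above3 _ _ (scale (x ^+ k) K1) (scale (x ^+ k) K2)) IHk.
  - exact/scale_is_ideal/mulset_is_ideal.
  - exact: scale_is_ideal.
  - exact: scale_is_ideal.
  - exact: scale_proper.
  - exact: scale_proper.
  - exact: scale_proper.
pose j := (p + s - n0)%N.
have ej k : (p + s + k = n0 + (j + k))%N by rewrite /j; lia.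
(* Large enough for 3k > l0 + 2 (j + k). *)
pose k := (l0 + 2 * j).+1.
have : chain_above (M (n0 + (j + k))) (3 * k).
  rewrite -ej; apply: chain_above_sub (chainI k).
  exact: subset_trans (reduction_shift (k := s) (j := k) red) (scaleS MI).
move=> /max_chain_leq /(_ (lenM _)); rewrite /k; lia.
Qed.
End Domain.


(** * Minors *)

Section Minors.
Context {R : comNzRingType}.

(** The sorting permutation sends i to the number of smaller values of f. *)
Lemma injective_ord_sort t n (f : 'I_t -> 'I_n) : injective f ->
  exists (s : 'S_t) (h : 'I_t -> 'I_n),
    (forall i j : 'I_t, (i < j)%N -> (h i < h j)%N) /\ f =1 h \o s.
Proof.
move=> f_inj; pose below i := [set k | f k < f i]%N%SET.
have below_lt i : (#|below i| < t)%N.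
  rewrite -[X in (_ < X)%N]card_ord -cardsT; apply: proper_card.
  by apply/properP; split; [exact: finset.subsetT|exists i; rewrite !inE ?ltnn].
have rank_le i j : (f i <= f j)%N -> (#|below i| <= #|below j|)%N.
  move=> le_ij; apply/subset_leq_card/fintype.subsetP => k; rewrite !inE => lt_k.
  exact: leq_trans lt_k le_ij.
have rank_lt i j : (f i < f j)%N -> (#|below i| < #|below j|)%N.
  move=> lt_ij; apply: proper_card; apply/properP; split.
    apply/fintype.subsetP => k; rewrite !inE => lt_k.
    exact: leq_trans lt_k (ltnW lt_ij).
  by exists i; rewrite !inE ?ltnn.
pose rank i := Ordinal (below_lt i).
have rank_inj : injective rank.
  move=> i j /(congr1 val) /= e; apply/f_inj/val_inj.
  by case: (ltngtP (f i) (f j)) => // /rank_lt; rewrite e ltnn.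
exists (perm rank_inj), (f \o (perm rank_inj)^-1%g); split=> [i j lt_ij|i] /=.
  rewrite ltnNge; apply/negP => /rank_le.
  rewrite -[#|below ((perm rank_inj)^-1%g j)|]/(val (rank _)).
  rewrite -[#|below ((perm rank_inj)^-1%g i)|]/(val (rank _)).
  by rewrite -!(permE rank_inj) !permKV leqNgt lt_ij.
by rewrite permK.
Qed.

(** Selections with repetitions give 0; the others are minors up to a
    permutation of rows and columns. *)
Lemma det_mxsub_minors t n r (A : 'M[R]_(n, r)) (S : set R)
    (f : 'I_t -> 'I_n) (g : 'I_t -> 'I_r) :
  is_ideal S -> (forall x, is_minor t A x -> S x) -> S (\det (mxsub f g A)).
Proof.
move=> [S0 _ SZ] minS.
have [f_inj|/injectivePn[i [j ij fij]]] := boolP (injectiveb f); last first.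
  by rewrite (determinant_alternate ij) // => k; rewrite !mxE fij.
have [g_inj|/injectivePn[i [j ij gij]]] := boolP (injectiveb g); last first.
  rewrite -det_tr (determinant_alternate ij) // => k; rewrite !mxE.
  by rewrite gij.
have [s [h [h_inc fE]]] := injective_ord_sort (injectiveP _ f_inj).
have [s' [h' [h'_inc gE]]] := injective_ord_sort (injectiveP _ g_inj).
have -> : mxsub f g A = row_perm s (col_perm s' (mxsub h h' A)).
  by apply/matrixP => k l; rewrite !mxE fE gE.
rewrite row_permE det_mulmx col_permE det_mulmx mulrC -mulrA mulrC -mulrA.
by apply/SZ/SZ/minS; exists h, h'.
Qed.

(** Multilinear expansion of the rows of W A along the rows of A, a weak form of
    the Cauchy-Binet formula. *)
Lemma det_mulmx_minors t n r (A : 'M[R]_(n, r)) (W : 'M[R]_(t, n))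
    (g : 'I_t -> 'I_r) (S : set R) :
  is_ideal S -> (forall x, is_minor t A x -> S x) ->
  S (\det (mxsub id g (W *m A))).
Proof.
move=> idS minS.
have -> : \det (mxsub id g (W *m A)) = \sum_(f : {ffun 'I_t -> 'I_n})
    (\prod_i W i (f i)) * \det (mxsub f g A).
  rewrite /determinant; under [RHS]eq_bigr do rewrite mulr_sumr.
  rewrite exchange_big /=; apply: eq_bigr => s _.
  under [RHS]eq_bigr do rewrite mulrCA.
  rewrite -mulr_sumr; congr (_ * _).
  under eq_bigr do rewrite !mxE.
  rewrite bigA_distr_bigA /=; apply: eq_bigr => f _.
  by rewrite -big_split /=; apply: eq_bigr => i _; rewrite !mxE.
apply: is_ideal_sum => // f; have [_ _] := idS; apply.
exact: det_mxsub_minors.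
Qed.

(** The signed maximal minors, i.e. the cofactors along a row added on top of B. *)
Definition max_minor r (B : 'M[R]_(r, r.+1)) (c : 'I_r.+1) : R :=
  (-1) ^+ c * \det (mxsub id (lift c) B).

(** The vector of signed maximal minors is proportional to any vector a in the
    kernel of B. Let N be B with the row v added on top: N a is v.a times the
    first unit vector and \det N is the product of v with the vector of minors, so
    the identity is coordinate c of \adj N N a = \det N a. *)
Lemma max_minor_proportional r (B : 'M[R]_(r, r.+1)) (a v : 'I_r.+1 -> R) c :
  (forall k, \sum_l B k l * a l = 0) ->
  (\sum_l v l * a l) * max_minor B c = (\sum_l v l * max_minor B l) * a c.
Proof.
move=> Ba; pose N := \matrix_(k < r.+1, l < r.+1)
  if unlift ord0 k is Some k' then B k' l else v l.
pose u := \col_l a l.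
have cofN l : cofactor N ord0 l = max_minor B l.
  rewrite /cofactor add0n; congr (_ * \det _).
  by apply/matrixP => k k'; rewrite !mxE liftK.
have detN : \det N = \sum_l v l * max_minor B l.
  rewrite (expand_det_row _ ord0); apply: eq_bigr => l _.
  by rewrite cofN mxE unlift_none.
have Nu k : (N *m u) k ord0 = if k == ord0 then \sum_l v l * a l else 0.
  rewrite mxE; case: (unliftP ord0 k) => [k'|] -> /=.
    by rewrite -[RHS](Ba k'); apply: eq_bigr => l _; rewrite !mxE liftK.
  by apply: eq_bigr => l _; rewrite !mxE unlift_none.
have := congr1 (fun X => (X *m u) c ord0) (mul_adj_mx N).
rewrite -mulmxA mul_scalar_mx [RHS]mxE [u _ _]mxE detN => <-.
rewrite [RHS]mxE [RHS](bigD1 ord0) //= Nu eqxx [X in _ + X]big1 ?addr0; last first.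
  by move=> k /negPf k0; rewrite Nu k0 mulr0.
by rewrite mxE cofN mulrC.
Qed.
End Minors.


(** * Trace ideals *)

Section Trace.
Context {R : comNzRingType}.

Lemma trace_is_ideal (M : lmodType R) : is_ideal (trace M).
Proof.
split=> [|x y [n [f [u ->]]] [p [g [v ->]]]|a x [n [f [u ->]]]].
- have none (T : Type) (i : 'I_0) : T by case: i.
  by exists 0%N, (none _), (none _); rewrite big_ord0.
- exists (n + p)%N.
  exists (fun i => match fintype.split i with inl j => f j | inr k => g k end).
  exists (fun i => match fintype.split i with inl j => u j | inr k => v k end).
  rewrite big_split_ord; congr (_ + _); apply: eq_bigr => i _.
    by rewrite (unsplitK (inl i)).
  by rewrite (unsplitK (inr i)).
- exists n, f, (fun i => a *: u i); rewrite mulr_sumr; apply: eq_bigr => i _.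
  by rewrite linearZ.
Qed.

Lemma trace_mem (M : lmodType R) (f : {linear M -> R^o}) v : trace M (f v).
Proof. by exists 1%N, (fun=> f), (fun=> v); rewrite big_ord1. Qed.

Lemma trace_sub (M : lmodType R) (S : set R) : is_ideal S ->
  (forall (f : {linear M -> R^o}) v, S (f v)) -> trace M `<=` S.
Proof. by move=> idS fS _ [n [f [v ->]]]; apply: is_ideal_sum => // i; apply: fS. Qed.

Lemma sub_trace (I : ideal R) : [set` I] `<=` trace (submod_type I).
Proof.
move=> x Ix; have -> : x = \val (SubmodType Ix) by [].
exact: (trace_mem (\val : {linear submod_type I -> R^o})).
Qed.

(** If I is the trace of M, every h : I -> R composes with the maps M -> R, which
    take their values in I, so h sends I into the trace of M, that is, into I. *)
Lemma trace_idealP (I : ideal R) :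
  trace_ideal I <-> trace (submod_type I) = [set` I].
Proof.
split=> [[M IM]|e]; last by exists (submod_type I); rewrite e.
apply/seteqP; split; last exact: sub_trace.
apply: trace_sub (ideal_is_ideal I) _ => h [x Ix].
have fI (f : {linear M -> R^o}) v : f v \in I.
  by have : trace M (f v) := trace_mem f v; rewrite -IM.
have [n [f [v xE]]] : trace M x by rewrite -IM.
rewrite IM; have -> : SubmodType Ix = \sum_i SubmodType (fI (f i) (v i)).
  by apply: val_inj; rewrite raddf_sum.
rewrite linear_sum; apply: is_ideal_sum; first exact: trace_is_ideal.
move=> i; pose g w := h (SubmodType (fI (f i) w)).
have g_lin : linear g.
  move=> a w w'; rewrite /g -linearP; congr (h _).
  by apply: val_inj; rewrite /= linearP.
pose G := GRing.isLinear.Build R M R^o *:%R g g_lin.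
exact: (trace_mem (HB.pack g G : {linear M -> R^o})).
Qed.

End Trace.

(** * The first Fitting ideal and the trace *)

Section Fitting.
Context {R : idomainType} (I : ideal R).
Hypothesis I_neq0 : exists2 x : R, x \in I & x != 0.
Notation M := (submod_type I).

(** The maps from I to R are the multiplications by elements d/b of the fraction
    field. *)
Lemma linear_from_ratio (b d : R) (h : M -> R^o) : b != 0 ->
  (forall y, h y * b = \val y * d) -> linear h.
Proof.
move=> b0 hE k y z; apply: (mulIf b0); rewrite mulrDl hE /=.
by rewrite -mulrA hE [h z * b]hE mulrDl -mulrA.
Qed.

Section Presentation.
Context (r : nat) (phi : {linear 'rV[R]_r.+1 -> M}).
Hypothesis phi_surj : forall y, exists v, phi v = y.
Let a c : R := \val (phi (delta_mx ord0 c)).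

Lemma phiE v : \val (phi v) = \sum_c v ord0 c * a c.
Proof.
rewrite [v in LHS]row_sum_delta linear_sum raddf_sum; apply: eq_bigr => c _.
by rewrite linearZ.
Qed.

Lemma gens_neq0 : exists c, a c != 0.
Proof.
have [x Ix x0] := I_neq0; apply: contrapT => na; move/negP: x0; apply.
have [v vx] := phi_surj (SubmodType Ix); have := phiE v; rewrite vx /= => ->.
rewrite big1 // => c _; have -> : a c = 0; last by rewrite mulr0.
by apply: contrapT => ac; apply: na; exists c; apply/eqP.
Qed.

(** By proportionality to the generators a, the signed minors of B are the values
    at the a's of a single linear map on I. *)
Lemma max_minor_trace (B : 'M[R]_(r, r.+1)) c :
  (forall k, \sum_l B k l * a l = 0) -> trace M (max_minor B c).
Proof.
move=> Ba; have [c0 ac0] := gens_neq0.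
have [w wK] := choice phi_surj.
pose h y : R^o := \sum_l w y ord0 l * max_minor B l.
have hE y : h y * a c0 = \val y * max_minor B c0.
  by rewrite -(max_minor_proportional _ _ Ba) -phiE wK.
pose H := GRing.isLinear.Build R M R^o *:%R h (linear_from_ratio ac0 hE).
have -> : max_minor B c = (HB.pack h H : {linear M -> R^o}) (phi (delta_mx ord0 c)).
  apply: (mulIf ac0); rewrite /= hE -[\val _]/(a c).
  have delta_sum (F : 'I_r.+1 -> R) : \sum_l (l == c)%:R * F l = F c.
    rewrite (bigD1 c) //= eqxx mul1r big1 ?addr0 // => l /negPf ->.
    by rewrite mul0r.
  have := max_minor_proportional (fun l => (l == c)%:R) c0 Ba.
  by rewrite !delta_sum.
exact: trace_mem.
Qed.

(** The rows of A are relations between the generators a, and r columns out of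
    r + 1 miss exactly one. *)
Lemma minor_trace n (A : 'M[R]_(n, r.+1)) x :
  (forall v, phi v = 0 <-> exists w : 'rV[R]_n, v = w *m A) ->
  is_minor r A x -> trace M x.
Proof.
move=> kerA [f [g [_ g_inc ->]]]; pose B := rowsub f A.
have [T0 _ TZ] := trace_is_ideal M.
have g_inj : injective g.
  move=> i j /(congr1 val) /= e; apply: val_inj => /=.
  by case: (ltngtP i j) => // /g_inc; rewrite e ltnn.
have [c gc] : exists c, forall k, c != g k.
  apply: contrapT => nc; suff : (#|'I_r.+1| <= #|'I_r|)%N by rewrite !card_ord ltnn.
  rewrite -(card_codom g_inj); apply/subset_leq_card/fintype.subsetP => c _.
  apply: contrapT => cg; apply: nc; exists c => k.
  by apply: contra_not_neq cg => ->; apply: codom_f.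
pose s k := odflt k (unlift c (g k)).
have sE k : g k = lift c (s k).
  by rewrite /s; have [j -> ->] := unlift_some (gc k).
have s_inj : injective s by move=> k l e; apply: g_inj; rewrite !sE e.
have -> : mxsub f g A = col_perm (perm s_inj) (mxsub id (lift c) B).
  by apply/matrixP => k l; rewrite !mxE permE sE.
rewrite col_permE det_mulmx mulrC.
apply: (TZ) => {s s_inj sE}.
have -> : \det (mxsub id (lift c) B) = (-1) ^+ c * max_minor B c.
  by rewrite /max_minor mulrA -expr2 sqrr_sign mul1r.
apply: TZ; apply: max_minor_trace => k.
have : phi (row (f k) A) = 0 by apply/kerA; exists (delta_mx ord0 (f k)); rewrite rowE.
move=> /(congr1 \val); rewrite phiE => e.
by rewrite -[RHS]e; apply: eq_bigr => l _; rewrite !mxE.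
Qed.

(** If a_i and a_j generate I, each other generator a_c has a relation
    a_c - p_c a_i - q_c a_j = 0, and any h gives h(a_i) a_j - h(a_j) a_i = 0. Putting
    the latter in the row of j and deleting column i leaves a matrix that is the
    identity outside column j, with h(a_i) on the diagonal there and zeros in the
    rest of row j: its determinant is h(a_i). These relations are combinations of
    the rows of A. *)
Lemma hom_gen_minors n (A : 'M[R]_(n, r.+1)) (h : {linear M -> R^o}) i j :
  (forall v, phi v = 0 <-> exists w : 'rV[R]_n, v = w *m A) ->
  i != j -> (forall y : M, exists p q, \val y = p * a i + q * a j) ->
  minors_ideal r A (h (phi (delta_mx ord0 i))).
Proof.
move=> kerA ij gen; have [j0 jE _] := unlift_some ij.
pose e c : 'rV[R]_r.+1 := delta_mx ord0 c.
have [p /choice[q pq]] := choice (fun c => gen (phi (e c))).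
pose row_ (l : 'I_r) := if l == j0 then h (phi (e i)) *: e j - h (phi (e j)) *: e i
  else e (lift i l) - p (lift i l) *: e i - q (lift i l) *: e j.
have row_ker l : exists w : 'rV[R]_n, row_ l = w *m A.
  have valB k u v : \val (phi (u - k *: v)) = \val (phi u) - k * \val (phi v).
    rewrite !phiE mulr_sumr -sumrB; apply: eq_bigr => c _.
    by rewrite !mxE mulrBl mulrA.
  have valZ k v : \val (phi (k *: v)) = k * \val (phi v).
    by rewrite !phiE mulr_sumr; apply: eq_bigr => c _; rewrite mxE mulrA.
  have E : \val (phi (e i)) *: h (phi (e j)) = \val (phi (e j)) *: h (phi (e i)).
    rewrite -!linearZ; congr (h _); apply: val_inj.
    by rewrite !linearZ; apply: mulrC.
  apply/kerA/val_inj; rewrite /row_; case: ifP => _.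
    rewrite valB valZ [X in X - _]mulrC -[_ * _]/(_ *: _) -E.
    by rewrite [X in _ - X]mulrC; apply: subrr.
  by rewrite !valB pq -[\val (phi (e i))]/(a i) -[\val (phi (e j))]/(a j)
    addrAC addrK subrr.
have [w wE] := choice row_ker; pose W := \matrix_l w l.
pose D := mxsub id (lift i) (W *m A).
have WA : W *m A = \matrix_l row_ l.
  by apply/row_matrixP => l; rewrite row_mul !rowK wE.
have DE l c : D l c = row_ l ord0 (lift i c) by rewrite mxE WA mxE.
have -> : h (phi (e i)) = \det D.
  have Dj c : D j0 c = h (phi (e i)) * (c == j0)%:R.
    rewrite DE /row_ eqxx !mxE jE (inj_eq (@lift_inj _ i)) eqxx /=.
    by rewrite [lift i c == i]eq_sym (negPf (neq_lift _ _)) mulr0 subr0.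
  rewrite (expand_det_row _ j0) (bigD1 j0) //= Dj eqxx mulr1 big1 ?addr0.
    rewrite /cofactor -signr_odd addnn odd_double mul1r.
    rewrite (_ : row' _ _ = 1%:M) ?det1 ?mulr1 //.
    apply/matrixP => k l; rewrite mxE mxE DE /row_ eq_sym (negPf (neq_lift _ _)).
    rewrite !mxE jE !(inj_eq (@lift_inj _ _)) eqxx /=.
    rewrite ![lift i _ == i]eq_sym (negPf (neq_lift _ _)).
    rewrite [lift j0 l == j0]eq_sym (negPf (neq_lift _ _)) !mulr0 !subr0.
    by rewrite eq_sym.
  by move=> c /negPf cj; rewrite Dj cj mulr0 mul0r.
apply: det_mulmx_minors; first exact: ideal_gen_is_ideal.
by move=> x mx; apply: sub_ideal_gen.
Qed.
End Presentation.
End Fitting.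


(** * Generators and presentations *)

Section Generators.
Context {R : comNzRingType} (m : ideal R).
Hypotheses (noethR : noetherian R) (localR : local_ring m).

Lemma adj2P (a b y : R) : adj (adj [set 0] a) b y <-> exists p q, y = p * a + q * b.
Proof.
split=> [[q [p /eqP]]|[p [q ->]]]; last by exists q, p; rewrite /= addrK subrr.
by rewrite subr_eq0 subr_eq => /eqP ->; exists p, q.
Qed.

Lemma ideal_gen_seqP (s : seq R) x : ideal_gen [set` s] x ->
  exists w : 'I_(size s) -> R, x = \sum_i w i * s`_i.
Proof.
pose S : set R := [set x | exists w : 'I_(size s) -> R, x = \sum_i w i * s`_i].
apply: (@ideal_gen_sub _ _ S) x => [|x /= xs].
  split=> [|x y [w ->] [w' ->]|a x [w ->]].
  - by exists (fun=> 0); rewrite big1 // => i _; rewrite mul0r.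
  - exists (fun i => w i + w' i); rewrite -big_split; apply: eq_bigr => i _.
    by rewrite mulrDl.
  - by exists (fun i => a * w i); rewrite mulr_sumr; apply: eq_bigr => i _; rewrite mulrA.
have lt_x : (index x s < size s)%N by rewrite index_mem.
exists (fun i => (i == Ordinal lt_x)%:R); rewrite (bigD1 (Ordinal lt_x)) //=.
rewrite eqxx mul1r nth_index // big1 ?addr0 // => i /negPf ->.
by rewrite mul0r.
Qed.

(** By Nakayama's lemma it suffices to generate modulo m I, where a greedy choice
    among the e's stops after one or two steps. The two generators thus belong to
    the given family, as the determinant computation with an arbitrary
    presentation needs. *)
Lemma generating_pair (T : Type) (e : T -> R) (I : set R) :
    is_ideal I -> (exists2 x, I x & x != 0) ->
    length_le2 (mulset [set` m] I) I -> (forall c, I (e c)) ->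
    (forall S, is_ideal S -> (forall c, S (e c)) -> I `<=` S) ->
  exists i, e i <> 0 /\ ((forall j, I `<=` adj (adj [set 0] (e i)) (e j)) \/
    exists j, e j <> e i /\ I `<=` adj (adj [set 0] (e i)) (e j)).
Proof.
move=> idI [x Ix x0] len2 Ie genI.
have idm := mulset_is_ideal [set` m] I.
have mI : mulset [set` m] I `<=` I by exact: mulset_subr.
have m0 : mulset [set` m] I 0 by case: idm.
have [i ni] : exists i, ~ mulset [set` m] I (e i).
  apply: contrapT => ni; move/eqP: x0; apply.
  apply: (nakayama0 noethR localR idI) x Ix; apply: genI => // c.
  by apply: contrapT => nc; apply: ni; exists c.
exists i; split; first by move=> ei; apply: ni; rewrite ei.
have [[j nj]|nj] := pselect (exists j, ~ adj (mulset [set` m] I) (e i) (e j)).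
  right; exists j; split; first by move=> eji; apply: nj; rewrite eji; apply: adj_mem.
  by apply: (nakayama_adj2 noethR localR) => //; apply: len2.
left=> j; apply: (nakayama_adj2 noethR localR) => //.
apply: subset_trans (@sub_adj _ _ _); apply: genI; first exact: adj_is_ideal.
by move=> c; apply: contrapT => nc; apply: nj; exists c.
Qed.
End Generators.

(** As a is nonzero, a relation p a + q b = 0 is determined by q, which ranges over
    the colon ideal (a : b). Generators of that ideal therefore give a finite
    generating set of relations. *)
Lemma two_generated_presentation (R : idomainType) (I : ideal R) (a b : R) :
    noetherian R -> a != 0 -> a \in I -> b \in I ->
    (forall y, y \in I -> exists p q, y = p * a + q * b) ->
  exists n (A : 'M[R]_(n, 2)), presents (submod_type I) A.
Proof.
move=> noethR a0 Ia Ib genI.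
pose C : set R := [set q | exists p, p * a + q * b = 0].
have idC : is_ideal C.
  split=> [|q q' [p e] [p' e']|k q [p e]].
  - by exists 0; rewrite !mul0r addr0.
  - by exists (p + p'); rewrite !mulrDl addrACA e e' addr0.
  - by exists (k * p); rewrite -!mulrA -mulrDr e mulr0.
have [J JC] := is_ideal_ideal idC; have [s sC] := noethR J.
rewrite JC in sC.
have sP (k : 'I_(size s)) : C s`_k.
  by rewrite sC; apply: sub_ideal_gen; rewrite /= mem_nth.
have [p pP] := choice sP.
pose A := \matrix_(k < size s, l < 2) if l == ord0 then p k else s`_k.
pose l1 : 'I_2 := lift ord0 ord0.
have phiI (v : 'rV[R]_2) : v ord0 ord0 * a + v ord0 l1 * b \in I.
  by have [_ ID IZ] := ideal_is_ideal I; apply: ID; apply: IZ.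
pose phi v : submod_type I := SubmodType (phiI v).
have phi_lin : linear phi.
  move=> k u v; apply: val_inj; rewrite /= !mxE /=.
  by rewrite /GRing.scale /=; ring.
pose H := GRing.isLinear.Build R 'rV[R]_2 (submod_type I) *:%R phi phi_lin.
exists (size s), A, (HB.pack phi H : {linear 'rV[R]_2 -> submod_type I}) => /=.
  move=> [y Iy]; have [q [q' yE]] := genI _ Iy.
  exists (\row_l if l == ord0 then q else q'); apply: val_inj.
  by rewrite /= !mxE.
move=> v; split=> [/(congr1 \val) /= e|[w ->]].
  have : C (v ord0 l1) by exists (v ord0 ord0).
  rewrite sC => /ideal_gen_seqP[w wE].
  exists (\row_k w k); apply/rowP => l; rewrite mxE.
  case: (unliftP ord0 l) => [l'|] ->; last first.
    apply: (mulIf a0); move/eqP: e; rewrite addr_eq0 => /eqP ->.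
    rewrite wE -mulNr -sumrN !mulr_suml; apply: eq_bigr => k _; rewrite !mxE /=.
    have /eqP := pP k; rewrite addr_eq0 => /eqP e.
    by rewrite -mulrA e mulrN !mulNr mulrA.
  rewrite (ord1 l') -/l1 wE; apply: eq_bigr => k _; rewrite !mxE.
  by case: eqP.
apply: val_inj; rewrite /= !mxE !mulr_suml -big_split big1 // => k _.
by rewrite /= !mxE /= -!mulrA -mulrDr pP mulr0.
Qed.

Lemma minors_ideal_trace (R : idomainType) (I : ideal R) n r (A : 'M[R]_(n, r.+1))
    (phi : {linear 'rV[R]_r.+1 -> submod_type I}) (i j : 'I_r.+1) :
    (exists2 x : R, x \in I & x != 0) ->
    (forall y, exists v, phi v = y) ->
    (forall v, phi v = 0 <-> exists w : 'rV[R]_n, v = w *m A) ->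
    i != j ->
    [set` I] `<=` adj (adj [set 0] (\val (phi (delta_mx ord0 i))))
                      (\val (phi (delta_mx ord0 j))) ->
  minors_ideal r A = trace (submod_type I).
Proof.
move=> I_neq0 phi_surj kerA ij genI.
have gen (y : submod_type I) : exists p q, \val y =
    p * \val (phi (delta_mx ord0 i)) + q * \val (phi (delta_mx ord0 j)).
  by apply/adj2P/genI; case: y.
have gen' (y : submod_type I) : exists p q, \val y =
    p * \val (phi (delta_mx ord0 j)) + q * \val (phi (delta_mx ord0 i)).
  by have [p [q ->]] := gen y; exists q, p; rewrite addrC.
have idA : is_ideal (minors_ideal r A) by exact: ideal_gen_is_ideal.
apply/seteqP; split.
  apply: ideal_gen_sub; first exact: trace_is_ideal.
  by move=> x; apply: minor_trace kerA.
apply: trace_sub => // h y; have [p [q yE]] := gen y.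
have -> : y = p *: phi (delta_mx ord0 i) + q *: phi (delta_mx ord0 j).
  by apply: val_inj; rewrite yE linearD !linearZ.
have [_ AD AZ] := idA.
rewrite linearD !linearZ; apply: AD; apply: AZ.
  exact: hom_gen_minors kerA ij gen.
by apply: hom_gen_minors kerA _ gen'; rewrite eq_sym.
Qed.

(** The presentation behind the Fitting ideal is arbitrary, so two of its own
    generators are selected that generate I. With a single generator both sides are
    R, the minors of size 0 being 1. *)
Lemma fitting_ideal_trace (R : idomainType) (m I : ideal R)
    (noethR : noetherian R) (localR : local_ring m) (dimR : krull_dim R 1)
    (multR : multiplicity m 2) (I_neq0 : exists2 x : R, x \in I & x != 0) :
  fitting_ideal 1 (submod_type I) = trace (submod_type I).
Proof.
have idI := ideal_is_ideal I.
have len2 := ideal_length_le2 noethR localR dimR multR idI I_neq0.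
have pair := generating_pair noethR localR idI I_neq0 len2.
have [n0 [A0 presA0]] :
    exists n (A : 'M[R]_(n, 2)), presents (submod_type I) A.
  have [|S _ Se x Ix|i [i0 gen]] := pair (submod_type I) (fun y => \val y).
  - by case.
  - exact: (Se (SubmodType Ix)).
  have [j genI] : exists j : submod_type I,
      [set` I] `<=` adj (adj [set 0] (\val i)) (\val j).
    by case: gen => [gen|[j [_ gen]]]; [exists i|exists j].
  apply: (@two_generated_presentation _ _ (\val i) (\val j)) => //.
  - exact/eqP.
  - by case: (i).
  - by case: (j).
  - by move=> y Iy; apply/adj2P/genI.
rewrite /fitting_ideal.
have [|n [r [A [[phi phi_surj kerA] ->]]]] := @xgetPex _ set0 [set J |
    exists n r (A : 'M[R]_(n, r)),
      presents (submod_type I) A /\ J = minors_ideal (r - 1) A].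
  by exists (minors_ideal (2 - 1) A0), n0, 2%N, A0.
case: r => [|r] in A phi phi_surj kerA *.
  have [x Ix /eqP x0] := I_neq0; case: x0.
  have [v vE] := phi_surj (SubmodType Ix).
  by have := congr1 \val vE; rewrite (thinmx0 v) linear0.
rewrite subn1 /=.
have [|S idS Sa x Ix|i [i0 gen]] :=
  pair 'I_r.+1 (fun c => \val (phi (delta_mx ord0 c))).
- by move=> c; case: (phi _).
- have [v vE] := phi_surj (SubmodType Ix).
  have -> : x = \val (phi v) by rewrite vE.
  by rewrite phiE; apply: is_ideal_sum => // c; case: idS => _ _; apply.
case: gen => [gen|[j [ji gen]]]; last first.
  apply: (minors_ideal_trace (i := i) (j := j)) kerA _ gen => //.
  by apply/eqP => ij; apply: ji; rewrite ij.
case: r => [|r] in A phi phi_surj kerA i i0 gen *; last first.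
  apply: (minors_ideal_trace (i := i) (j := lift i ord0)) kerA _ (gen _) => //.
  exact: neq_lift.
apply/seteqP; split.
  apply: ideal_gen_sub; first exact: trace_is_ideal.
  by move=> x; apply: minor_trace kerA.
move=> x _; rewrite -[x]mulr1; have [_ _] := ideal_gen_is_ideal
  [set x | is_minor 0 A x]; apply; apply: sub_ideal_gen.
have none (T : Type) (k : 'I_0) : T by case: k.
by exists (none _), (none _); split=> [[]|[]|] //; rewrite det_mx00.
Qed.

Theorem corollary3p4 (R : idomainType) (m I : ideal R)
    (noethR : noetherian R) (localR : local_ring m) (dimR : krull_dim R 1)
    (infk : infinite_set (residue_field m)) (multR : multiplicity m 2)
    (I_neq0 : exists2 x : R, x \in I & x != 0) :
  fitting_ideal 1 (submod_type I) = [set` I] <-> trace_ideal I.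
Proof.
by rewrite (fitting_ideal_trace noethR localR dimR multR I_neq0) trace_idealP.
Qed.
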